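(* If $G$ is a finite graph of maximum average degree $d \geq 4$, then $\chi^\ast_{DP}(G) \geq d/(2\ln d)$.
   Context: All graphs are finite, without loops or multiple edges. The average degree of a graph with nonempty vertex set is $2|E|/|V|$; the maximum average degree of $G$ is the largest average degree of a subgraph of $G$ with nonempty vertex set. A cover of a graph $G$ is a pair $(L,H)$ where $H$ is a graph and $L\colon V(G)\to 2^{V(H)}$ satisfies: the sets $L(u)$, $u\in V(G)$, partition $V(H)$; each $H[L(u)]$ is complete; if there is an edge of $H$ between $L(u)$ and $L(v)$ with $u\neq v$ then $uv\in E(G)$; and for each $uv\in E(G)$ the edges of $H$ between $L(u)$ and $L(v)$ form a (not necessarily perfect, possibly empty) matching. The cover is $k$-fold if $|L(u)|=k$ for all $u$. Edges of $H$ joining different sets $L(u)\ne L(v)$ are cross-edges; $S\subseteq V(H)$ is quasi-independent if it spans no cross-edges. For $\eta\in[0,1]$, an $(\eta,(L,H))$-coloring of $G$ is a quasi-independent $S\subseteq V(H)$ with $|S\cap L(u)|\geq \eta|L(u)|$ for all $u\in V(G)$. For $k\in\mathbb{N}^+$, $\theta_{DP}(G,k)$ is the maximum $\eta\in[0,1]$ such that $G$ admits an $(\eta,\mathcal{H})$-coloring for every $k$-fold cover $\mathcal{H}$ of $G$, and $\chi_{DP}^\ast(G)=\inf\{\theta_{DP}(G,k)^{-1}: k\in\mathbb{N}^+\}$. *)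

(* Defs.v *)
From HB Require Import structures.
From mathcomp Require Import all_boot all_order all_algebra.
From mathcomp Require Import all_classical all_reals all_analysis.

Set Implicit Arguments.
Unset Strict Implicit.
Unset Printing Implicit Defensive.

Import Order.TTheory GRing.Theory Num.Theory.

Local Open Scope ring_scope.

Record sgraph (V : finType) := SGraph {
  adj :> rel V;
  adj_sym : symmetric adj;
  adj_irr : irreflexive adj }.

(* An edge is the two-element set of its endpoints. *)
Definition edges (V : finType) (G : sgraph V) : {set {set V}} :=
  finset (fun e : {set V} =>
    [exists x, exists y, adj G x y && (e == [set x; y]%SET)]).

(* [(A, F)] is a (not necessarily induced) subgraph of [G], with vertex set [A]
   and edge set [F]. *)
Definition is_subgraph (V : finType) (G : sgraph V)
    (A : {set V}) (F : {set {set V}}) : bool :=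
  (F \subset edges G) && [forall e in F, e \subset A].

Definition avg_degree (R : realType) (V : finType)
    (A : {set V}) (F : {set {set V}}) : R :=
  (2 * #|F|)%:R / #|A|%:R.

(* All average degrees are nonnegative, so the default value 0 of the iterated
   maximum is only relevant when [G] has no vertex. *)
Definition mad (R : realType) (V : finType) (G : sgraph V) : R :=
  \big[Num.max/0]_(K : {set V} * {set {set V}} |
      is_subgraph G K.1 K.2 && (K.1 != finset.set0)) avg_degree R K.1 K.2.

Record cover (V : finType) (G : sgraph V) (W : finType) := Cover {
  cov_graph : sgraph W;
  cov_list : V -> {set W};
  cov_partition : forall w : W, exists! u : V, w \in cov_list u;
  cov_complete : forall (u : V) (x y : W),
    x \in cov_list u -> y \in cov_list u -> x != y -> adj cov_graph x y;
  cov_edge : forall (u v : V) (x y : W),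
    x \in cov_list u -> y \in cov_list v -> u != v ->
    adj cov_graph x y -> adj G u v;
  cov_matching : forall (u v : V) (x x' y y' : W), adj G u v ->
    x \in cov_list u -> x' \in cov_list u ->
    y \in cov_list v -> y' \in cov_list v ->
    adj cov_graph x y -> adj cov_graph x' y' -> (x = x' <-> y = y') }.

Section Covers.
Variables (V : finType) (G : sgraph V) (W : finType) (C : cover G W).

Definition kfold (k : nat) : Prop := forall u : V, #|cov_list C u| = k.

Definition cross_edge (x y : W) : Prop :=
  adj (cov_graph C) x y /\
  exists u v : V, [/\ u != v, x \in cov_list C u & y \in cov_list C v].

Definition quasi_independent (S : {set W}) : Prop :=
  forall x y : W, x \in S -> y \in S -> ~ cross_edge x y.

Definition is_coloring (R : realType) (eta : R) (S : {set W}) : Prop :=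
  quasi_independent S /\
  forall u : V, eta * #|cov_list C u|%:R <= #|S :&: cov_list C u|%:R.

End Covers.

Definition DP_fractions (R : realType) (V : finType) (G : sgraph V) (k : nat)
    : set R :=
  [set eta : R | 0 <= eta <= 1 /\
     forall (W : finType) (C : cover G W), kfold C k ->
       exists S : {set W}, is_coloring C eta S]%classic.
Arguments DP_fractions R {V} G k.

(* The supremum is a maximum for [0 < k]: see [theta_DP_max]. *)
Definition theta_DP (R : realType) (V : finType) (G : sgraph V) (k : nat) : R :=
  sup (DP_fractions R G k).

(* The inverse is taken in [\bar R], where [0^-1 = +oo]: [theta_DP R G k] may
   vanish for small [k], and the real inverse would then be 0. *)
Definition chi_DP_star (R : realType) (V : finType) (G : sgraph V) : \bar R :=
  ereal_inf [set ((theta_DP R G k)%:E^-1)%E | k in [set k : nat | (0 < k)%N]]%classic.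

Lemma theta_DP_max (R : realType) (V : finType) (G : sgraph V) (k : nat) :
  (0 < k)%N -> DP_fractions R G k (theta_DP R G k).
Proof.
move=> k0.
have k0R : 0 < k%:R :> R by rewrite ltr0n.
pose P j := `[< DP_fractions R G k (j%:R / k%:R) >].
have P0 : exists j, P j.
  exists 0%N; apply/asboolP; rewrite mul0r; split; first by rewrite lexx ler01.
  move=> W C _; exists finset.set0; split; first by move=> x y; rewrite inE.
  by move=> u; rewrite mul0r ler0n.
have Pk j : P j -> (j <= k)%N.
  by move=> /asboolP[/andP[_]]; rewrite ler_pdivrMr // mul1r ler_nat.
case: (ex_maxnP P0 Pk) => m /asboolP Pm mmax.
have ubm : ubound (DP_fractions R G k) (m%:R / k%:R).
  move=> eta [/andP[eta0 eta1] Peta].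
  have ek0 : 0 <= eta * k%:R by rewrite mulr_ge0 // ltW.
  have [j [ej jmin]] : exists j, eta * k%:R <= j%:R /\
      forall i, eta * k%:R <= i%:R -> (j <= i)%N.
    have ex : exists j, eta * k%:R <= j%:R.
      by exists k; rewrite ler_piMl // ltW.
    by case: (ex_minnP ex) => j ? ?; exists j.
  have Pj : P j.
    apply/asboolP; split.
      rewrite divr_ge0 ?ler0n //= ler_pdivrMr // mul1r ler_nat.
      by apply: jmin; rewrite ler_piMl // ltW.
    move=> W C kC; have [S [qS cS]] := Peta W C kC.
    exists S; split=> // u; have := cS u; rewrite kC => /jmin ji.
    by rewrite divfK ?gt_eqF // ler_nat.
  rewrite ler_pdivlMr //; apply: (le_trans ej).
  by rewrite ler_nat; exact: mmax.
suff -> : theta_DP R G k = m%:R / k%:R by [].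
apply/eqP; rewrite eq_le; apply/andP; split.
  by apply: ge_sup => //; exists (m%:R / k%:R).
by apply: ub_le_sup => //; exists (m%:R / k%:R).
Qed.

(* Main.v *)
(* Let [(A, F)] be a subgraph of average degree [d], with [n] vertices and [m]
   edges, so that [m = d n / 2].  Put an independent uniformly random perfect
   matching between the lists of the endpoints of each edge of [F].  For a fixed
   choice of [t] colours at each vertex of [A], an edge spans no cross-edge with
   probability at most [(1 - t / k) ^ t], so the expected number of
   quasi-independent choices is at most ['C(k, t) ^ n * (1 - t / k) ^ (t m)],
   which is less than 1 as soon as [t / k >= 2 ln d / d] and [e < 2 ln d]; the
   latter is where [d >= 4] is used. *)
Require Import Defs.
From mathcomp Require Import all_boot all_order all_algebra.
From mathcomp Require Import perm lra.
From mathcomp Require Import all_classical all_reals all_analysis.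

Import Order.TTheory GRing.Theory Num.Theory.

Local Open Scope ring_scope.

(** * Random matchings as random permutations *)

Lemma exchange_card (T U : finType) (r : T -> U -> bool) :
  (\sum_x #|[pred y | r x y]| = \sum_y #|[pred x | r x y]|)%N.
Proof.
under eq_bigr do rewrite -sum1_card big_mkcond.
by rewrite exchange_big /=; apply: eq_bigr => y _; rewrite -sum1_card -big_mkcond.
Qed.

(** For [A] and [B] the colours chosen at the two ends of an edge, these are the matchings that put
    no cross-edge between them. *)
Definition avoiding {k : nat} (A B : {set 'I_k}) : {set 'S_k} :=
  [set s : 'S_k | [forall a in A, s a \notin B]]%SET.

(* Composing with the transpositions [(a x)], [x \notin A], resamples the image
   of [a] uniformly among the points not in the image of [A]. *)
Lemma card_avoidingU1 {k : nat} (a : 'I_k) (A B : {set 'I_k}) : a \notin A ->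
  (#|avoiding (a |: A)%SET B| * (k - #|A|) =
   #|avoiding A B| * (k - #|A| - #|B|))%N.
Proof.
move=> aA.
(* The pairs in [r] are counted twice: [rowE] fixes [s], [colE] fixes the point [x] swapped with
   [a]. *)
pose r (s : 'S_k) (x : 'I_k) := [&& s \in avoiding A B, x \notin A & s x \notin B].
have rowE : (\sum_s #|[pred x | r s x]| = #|avoiding A B| * (k - #|A| - #|B|))%N.
  rewrite -sum_nat_const [RHS]big_mkcond; apply: eq_bigr => s _.
  case: ifPn => [sAB|/negbTE sF]; last by apply: eq_card0 => x; rewrite !inE /r sF.
  have dAB : [disjoint A & s @^-1: B]%SET.
    rewrite fintype.disjoint_subset; apply/fintype.subsetP => x xA; rewrite !inE.
    by move: sAB; rewrite inE => /forall_inP; exact.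
  have := leq_card_setU A (s @^-1: B)%SET; rewrite dAB => -[_ /eqP cU].
  rewrite -subnDA -(card_preimset B (@perm_inj _ s)) -cU.
  have := cardsC (A :|: s @^-1: B)%SET; rewrite card_ord => kE.
  rewrite -[X in (X - _)%N]kE addKn.
  by apply: eq_card => x; rewrite !inE /r sAB negb_or.
have colE : (\sum_x #|[pred s | r s x]| = #|avoiding (a |: A)%SET B| * (k - #|A|))%N.
  have -> : (k - #|A| = #|~: A|%SET)%N by rewrite [#|~: A|%SET]cardsCs finset.setCK card_ord.
  rewrite mulnC -sum_nat_const [RHS]big_mkcond; apply: eq_bigr => x _.
  rewrite finset.in_setC; case: ifPn => [xA|/negPn xA]; last first.
    by apply: eq_card0 => s; rewrite !inE /r xA !andbF.
  have hI : injective (fun s : 'S_k => (tperm a x * s)%g) by exact: mulgI.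
  rewrite -(card_preimset _ hI); apply: eq_card => s; rewrite !inE /r xA /= inE.
  apply/andP/forall_inP => [[/forall_inP sAB sx] b|sAB].
    rewrite permM; have [->|ba] := eqVneq b a; first by rewrite tpermL.
    rewrite !inE (negbTE ba) /= => bA; rewrite tpermD ?sAB 1?eq_sym //.
    by apply: contraNneq xA => <-.
  split; last by have := sAB a; rewrite !inE eqxx permM tpermL; exact.
  apply/forall_inP => b bA; have := sAB b; rewrite !inE bA orbT permM tpermD.
  - exact.
  - by apply: contraNneq aA => ->.
  - by apply: contraNneq xA => ->.
by rewrite -colE -exchange_card rowE.
Qed.

(** Once earlier images avoid [B], all of [B] is still available among at most [k] points, so the
    next image hits [B] with probability at least [#|B| / k]; the conditional bounds multiply. *)
Lemma card_avoiding_le (R : realType) {k : nat} (A B : {set 'I_k}) :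
  #|avoiding A B|%:R <= (1 - #|B|%:R / k%:R) ^+ #|A| * #|{: 'S_k}|%:R :> R.
Proof.
have [n] := ubnP #|A|; elim: n A => // n IH A.
have [->|[a aA]] := set_0Vmem A.
  by move=> _; rewrite cards0 expr0 mul1r ler_nat max_card.
rewrite (cardsD1 a) aA add1n ltnS => An; set A' := (A :\ a)%SET in An *.
have aA' : a \notin A' by rewrite !inE eqxx.
have kA : (#|A'| < k)%N.
  rewrite -[k in (_ < k)%N]card_ord -cardsT; apply: proper_card.
  by apply/properP; split; [exact: finset.subsetT|exists a].
have k0 : 0 < k%:R :> R by rewrite ltr0n (leq_ltn_trans _ kA).
have Bk : (#|B| <= k)%N by rewrite -[k in (_ <= k)%N]card_ord max_card.
have p0 : 0 <= 1 - #|B|%:R / k%:R :> R.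
  by rewrite subr_ge0 ler_pdivrMr // mul1r ler_nat.
rewrite exprS -mulrA; apply: le_trans (ler_wpM2l p0 (IH A' An)).
have := card_avoidingU1 a A' B aA'; rewrite finset.setD1K // => /(congr1 (fun m => m%:R : R)).
rewrite !natrM (natrB _ (ltnW kA)) => E.
have kA0 : 0 < k%:R - #|A'|%:R :> R by rewrite subr_gt0 ltr_nat.
rewrite -(ler_pM2r kA0) E mulrAC [leRHS]mulrC ler_wpM2l //.
(* If too few points remain outside [B], the truncated subtraction is 0, while the real difference
   could be negative. *)
have [kAB|kAB] := leqP (k - #|A'|) #|B|.
  by move: (kAB); rewrite -subn_eq0 => /eqP ->; rewrite mulr_ge0 // ltW.
rewrite natrB 1?ltnW // (natrB _ (ltnW kA)) mulrBl mul1r lerB //.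
rewrite mulrAC ler_pdivrMr // ler_wpM2l //.
by rewrite gerBl ler0n.
Qed.

(* Choosing the parameters one at a time, each by averaging, is the method of
   conditional expectations. *)
Lemma conditional_expectations (R : realType) (X P : finType) (E : eqType)
    (good : E -> P -> pred X) (p : R) (r : seq E) (X0 : {set X}) :
  0 <= p -> uniq r ->
  (forall e x, e \in r -> x \in X0 ->
     #|[set s | good e s x]%SET|%:R <= p * #|P|%:R) ->
  (0 < #|P|)%N ->
  exists sigma : E -> P,
    #|[set x in X0 | all (fun e => good e (sigma e) x) r]%SET|%:R
      <= p ^+ size r * #|X0|%:R.
Proof.
move=> p0 + + P0; have /card_gt0P[s0 _] := P0.
elim: r => [_ _|e r IH /= /andP[er ur] H].
  exists (fun=> s0); rewrite mul1r ler_nat subset_leq_card //.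
  by apply/fintype.subsetP => x; rewrite inE => /andP[].
have [|sigma sP] := IH ur.
  by move=> e' x e'r; apply: H; rewrite inE e'r orbT.
set X1 := [set x in _ | _]%SET in sP.
(* Some [s] leaves at most the average number of survivors. *)
have [s Hs] : exists s, #|[set x in X1 | good e s x]%SET|%:R <= p * #|X1|%:R.
  apply/not_existsP => Hn.
  have: \sum_(s : P) p * #|X1|%:R < \sum_(s : P) #|[set x in X1 | good e s x]%SET|%:R.
    apply: ltr_sum => [|s _]; first by apply/hasP; exists s0; rewrite ?mem_index_enum.
    by rewrite ltNge; apply/negP; exact: Hn.
  apply/negP; rewrite -leNgt -natr_sum.
  have -> : (\sum_s #|[set x in X1 | good e s x]%SET| =
      \sum_(x in X1) #|[set s | good e s x]%SET|)%N.
    under eq_bigr do rewrite -sum1_card big_mkcond.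
    rewrite exchange_big [RHS]big_mkcond; apply: eq_bigr => x _.
    case: ifPn => [xX|/negbTE xX]; last by rewrite big1 // => s; rewrite inE xX.
    by rewrite -sum1_card [RHS]big_mkcond; apply: eq_bigr => s _; rewrite inE xX inE.
  rewrite natr_sum sumr_const -[leRHS]mulr_natr.
  apply: (@le_trans _ _ (\sum_(x in X1) p * #|P|%:R)).
    by apply: ler_sum => x; rewrite inE => /andP[xX _]; rewrite H ?mem_head.
  by rewrite sumr_const -[leLHS]mulr_natr mulrAC.
(* Since [e] does not occur in [r], the earlier choices are unchanged. *)
exists (fun e' => if e' == e then s else sigma e').
rewrite exprS -mulrA; apply: le_trans (ler_wpM2l p0 sP); apply: le_trans Hs.
rewrite ler_nat subset_leq_card //; apply/fintype.subsetP => x.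
rewrite !inE eqxx => /and3P[-> -> ar]; rewrite andbT /=.
apply/allP => e' e'r; have := allP ar _ e'r.
by case: eqVneq => // ee; rewrite -ee e'r in er.
Qed.

(** * Numerical estimates *)

Lemma exp_coeff_le_expR (R : realType) (x : R) (n : nat) :
  0 <= x -> x ^+ n / n`!%:R <= expR x.
Proof.
move=> x0; case: n => [|n].
  by rewrite expr0 divr1 -expR0 ler_expR.
by apply: le_trans (expR_ge1Dxn n x0); rewrite lerDr.
Qed.

(* [109/40] is [1 + 1/1! + ... + 1/5!] plus the telescoping tail bound [1/5!]. *)
Lemma expR1_le (R : realType) : expR 1 <= 109 / 40 :> R.
Proof.
have S n : \sum_(0 <= i < n.+2.+4) (i`!%:R^-1 : R) <= 109 / 40 - (n.+1.+4)`!%:R^-1.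
  elim: n => [|n IH].
    by rewrite unlock /= !factS fact0; lra.
  rewrite big_nat_recr //=.
  suff: (n.+2.+4)`!%:R^-1 *+ 2 <= (n.+1.+4)`!%:R^-1 :> R by lra.
  have f0 : 0 < (n.+1.+4)`!%:R :> R by rewrite ltr0n fact_gt0.
  rewrite factS natrM invfM -mulrnAl -[leRHS]mul1r ler_pM2r ?invr_gt0 //.
  by rewrite -mulr_natl ler_pdivrMr ?ltr0n // mul1r ler_nat.
apply: limr_le; first exact: is_cvg_series_exp_coeff.
exists 6%N => // -[|[|[|[|[|[|n]]]]]] //= _.
apply: (@le_trans _ _ (109 / 40 - (n.+1.+4)`!%:R^-1)); last first.
  by rewrite gerBl invr_ge0.
apply: le_trans (S n); rewrite /series /=.
by apply: ler_sum => i _; rewrite /exp_coeff /= expr1n mul1r.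
Qed.

Lemma bin_le_expR (R : realType) (k t : nat) : (0 < t)%N ->
  'C(k, t)%:R <= (expR 1 * k%:R / t%:R) ^+ t :> R.
Proof.
move=> t0; have tR : 0 < t%:R :> R by rewrite ltr0n.
have f0 : 0 < t`!%:R :> R by rewrite ltr0n fact_gt0.
have ffact_le m : (k ^_ m <= k ^ m)%N.
  by elim: m => // m IH; rewrite ffactnSr expnSr leq_mul // leq_subr.
have Cle : 'C(k, t)%:R <= k%:R ^+ t / t`!%:R :> R.
  by rewrite ler_pdivlMr // -natrM bin_ffact -natrX ler_nat.
apply: (le_trans Cle).
have := @exp_coeff_le_expR R t%:R t (ltW tR).
rewrite -[X in expR X]mulr1 expRM_natl => H.
rewrite !exprMn exprVn ler_pdivlMr ?exprn_gt0 //.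
by rewrite mulrAC -mulrA [leRHS]mulrC ler_wpM2l ?exprn_ge0.
Qed.

Lemma expR1_lt_2ln (R : realType) (d : R) : 4 <= d -> expR 1 < 2 * ln d.
Proof.
move=> d4; have d0 : 0 < d by lra.
have e1 := expR1_le R.
(* The fraction [15 / 11] lies between [109 / 80], which bounds half of [expR 1], and [ln 4]; the
   latter comparison reduces to [(109 / 40) ^+ 15 <= 4 ^+ 11]. *)
have : expR (15 / 11) <= d.
  apply: le_trans d4.
  rewrite -(ler_pXn2r (n := 11)) ?nnegrE ?expR_ge0 //.
  rewrite -expRM_natl.
  have -> : 11%:R * (15 / 11) = 15%:R * 1 :> R by lra.
  rewrite expRM_natl.
  apply: (@le_trans _ _ ((109 / 40) ^+ 15)); last by lra.
  by rewrite lerXn2r ?nnegrE ?expR_ge0.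
by rewrite -ler_ln ?posrE ?expR_gt0 // expRK => ?; lra.
Qed.

(* ['C(k, t) <= (e k / t) ^ t < d ^ t], strictly because [e < 2 ln d], while the
   edges contribute at most [exp (- t m / k) <= d ^- n] per colour chosen. *)
Lemma union_bound_lt1 (R : realType) (d : R) (k t n m : nat) :
  4 <= d -> (0 < t)%N -> (t <= k)%N -> (0 < n)%N ->
  2 * ln d / d <= t%:R / k%:R -> d * n%:R = 2 * m%:R ->
  'C(k, t)%:R ^+ n * ((1 - t%:R / k%:R) ^+ t) ^+ m < 1 :> R.
Proof.
move=> d4 t0 tk n0 dt dn.
have d0 : 0 < d by lra.
have tR : 0 < t%:R :> R by rewrite ltr0n.
have kR : 0 < k%:R :> R by rewrite ltr0n (leq_trans t0).
have eln := expR1_lt_2ln R d d4.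
have e0 := @expR_gt0 R 1.
set tau := t%:R / k%:R in dt *.
have tau0 : 0 < tau by rewrite divr_gt0.
have tau1 : tau <= 1 by rewrite ler_pdivrMr // mul1r ler_nat.
have Clt : 'C(k, t)%:R < d ^+ t :> R.
  apply: le_lt_trans (bin_le_expR R k t t0) _.
  rewrite ltrXn2r -?lt0n // ?mulr_ge0 ?invr_ge0 ?expR_ge0 ?ler0n //.
  rewrite -mulrA -invf_div -/tau ltr_pdivrMr // mulrC.
  by apply: lt_le_trans eln _; rewrite -ler_pdivrMr.
(* Here [1 - tau <= expR (- tau)], and [tau * m >= n * ln d] because [m = d * n / 2]. *)
have mle : (1 - tau) ^+ m <= d ^- n.
  have : 1 - tau <= expR (- tau) by exact: expR_ge1Dx.
  move=> /(lerXn2r m) H; apply: le_trans (H _ _) _; rewrite ?nnegrE ?expR_ge0 ?subr_ge0 //.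
  rewrite -expRM_natl mulrN expRN lef_pV2 ?posrE ?expR_gt0 ?exprn_gt0 //.
  rewrite -{1}[d]lnK ?posrE // -expRM_natl ler_expR.
  move: dt; rewrite ler_pdivrMr // => dt.
  have := ler_wpM2l (ler0n R n) dt; have := congr1 ( *%R^~ tau) dn => /=; lra.
rewrite exprAC.
apply: (@le_lt_trans _ _ ('C(k, t)%:R ^+ n * (d ^- n) ^+ t)).
  rewrite ler_wpM2l ?exprn_ge0 ?ler0n // lerXn2r ?nnegrE ?exprn_ge0 ?subr_ge0 //.
  by rewrite invr_ge0 exprn_ge0 // ltW.
rewrite exprVn exprAC ltr_pdivrMr ?exprn_gt0 // mul1r ltrXn2r ?nnegrE ?ler0n ?exprn_ge0 ?ltW //.
by rewrite -lt0n.
Qed.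

(** * The cover given by a permutation on each edge *)

Lemma adj_of_edge {V : finType} (G : sgraph V) (u v : V) :
  u != v -> [set u; v]%SET \in edges G -> adj G u v.
Proof.
move=> uv; rewrite inE => /existsP[x /existsP[y /andP[xy /eqP E]]].
have: u \in [set x; y]%SET by rewrite -E set21.
have: v \in [set x; y]%SET by rewrite -E set22.
rewrite !inE => /orP[]/eqP vE /orP[]/eqP uE; move: uv; rewrite uE vE ?eqxx //.
by rewrite adj_sym.
Qed.

(* The permutation attached to an edge is read from its endpoint of smaller
   rank to the other one. *)
Definition perm_adj {V : finType} {k : nat} (F : {set {set V}})
    (sigma : {set V} -> 'S_k) : rel (V * 'I_k) :=
  fun x y =>
    if x.1 == y.1 then x.2 != y.2 else
    ([set x.1; y.1]%SET \in F) &&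
    (if (enum_rank x.1 < enum_rank y.1)%N
     then sigma [set x.1; y.1]%SET x.2 == y.2
     else sigma [set x.1; y.1]%SET y.2 == x.2).

Lemma perm_adj_sym {V : finType} {k : nat} (F : {set {set V}})
  (sigma : {set V} -> 'S_k) : symmetric (perm_adj F sigma).
Proof.
move=> x y; rewrite /perm_adj [y.1 == x.1]eq_sym [y.2 == x.2]eq_sym finset.setUC.
case: eqVneq => // xy; case: ltngtP => // /val_inj/enum_rank_inj E.
by rewrite E eqxx in xy.
Qed.

Lemma perm_adj_irr {V : finType} {k : nat} (F : {set {set V}})
  (sigma : {set V} -> 'S_k) : irreflexive (perm_adj F sigma).
Proof. by move=> x; rewrite /perm_adj !eqxx. Qed.

Definition fiber {V : finType} (k : nat) (u : V) : {set V * 'I_k} :=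
  [set w | w.1 == u]%SET.

Lemma card_fiberI {V : finType} {k : nat} (S : {set V * 'I_k}) (u : V) :
  #|S :&: fiber k u|%SET = #|[set i | (u, i) \in S]%SET|.
Proof.
have uI : injective (fun i : 'I_k => (u, i)) by move=> i j [].
rewrite -(card_imset _ uI); apply: eq_card => -[v i]; rewrite !inE /=.
apply/andP/imsetP => [[vS /eqP vu]|[j + [-> ->]]].
  by exists i; rewrite ?inE -vu.
by rewrite inE.
Qed.

Lemma card_fiber {V : finType} {k : nat} (u : V) : #|fiber k u| = k.
Proof.
rewrite -[fiber k u]finset.setTI card_fiberI -[RHS]card_ord.
by apply: eq_card => i; rewrite !inE.
Qed.

(** Injectivity of permutations gives the matching condition; edges of [G] outside [F] receive the
    empty matching. *)
Lemma perm_cover {V : finType} {k : nat} (G : sgraph V) (F : {set {set V}})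
    (sigma : {set V} -> 'S_k) : F \subset edges G ->
  exists C : Defs.cover G (V * 'I_k)%type,
    cov_list C = @fiber V k /\ adj (cov_graph C) = perm_adj F sigma.
Proof.
move=> FG.
pose H := SGraph (perm_adj_sym F sigma) (perm_adj_irr F sigma).
unshelve eexists (Cover (G := G) (cov_graph := H) (cov_list := fiber k) _ _ _ _) => //.
- move=> w; exists w.1; split; first by rewrite inE.
  by move=> u; rewrite inE => /eqP.
- move=> u [x1 x2] [y1 y2]; rewrite !inE /= /perm_adj /= => /eqP -> /eqP ->.
  by rewrite eqxx; apply: contraNneq => ->.
- move=> u v [x1 x2] [y1 y2]; rewrite !inE /= /perm_adj /= => /eqP -> /eqP -> uv.
  by rewrite (negbTE uv) => /andP[/(fintype.subsetP FG) e _]; exact: adj_of_edge.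
- move=> u v [x1 x2] [x1' x2'] [y1 y2] [y1' y2'] Guv; rewrite !inE /= /perm_adj /=.
  move=> /eqP -> /eqP -> /eqP -> /eqP ->.
  have uv : u != v by apply: contraTneq Guv => ->; rewrite adj_irr.
  rewrite (negbTE uv) => /andP[_ +] /andP[_].
  case: ifP => _ /eqP <- /eqP <-; split=> [[]|[]].
  + by move=> ->.
  + by move/perm_inj => ->.
  + by move/perm_inj => ->.
  + by move=> ->.
Qed.

(** * The bound on [theta_DP] and the conclusion *)

Lemma exists_subset_card {T : finType} (B : {set T}) (t : nat) :
  (t <= #|B|)%N -> exists2 B' : {set T}, B' \subset B & #|B'| = t.
Proof.
move=> tB; exists [set x in take t (enum B)]%SET.
  by apply/fintype.subsetP => x; rewrite inE => /mem_take; rewrite mem_enum.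
rewrite cardsE (card_uniqP _) ?take_uniq ?enum_uniq //.
by rewrite size_takel // -cardE.
Qed.

Lemma edge_ranked {V : finType} (G : sgraph V) (e : {set V}) : e \in edges G ->
  exists u v, e = [set u; v]%SET /\ (enum_rank u < enum_rank v)%N.
Proof.
rewrite inE => /existsP[x /existsP[y /andP[xy /eqP ->]]].
have [xly|ylx|/val_inj/enum_rank_inj E] := ltngtP (enum_rank x) (enum_rank y).
- by exists x, y.
- by exists y, x; rewrite finset.setUC.
- by move: xy; rewrite E adj_irr.
Qed.

Lemma theta_DP_le (R : realType) (V : finType) (G : sgraph V)
    (A : {set V}) (F : {set {set V}}) (k : nat) (d : R) :
  d = avg_degree R A F -> is_subgraph G A F -> A != finset.set0 -> 4 <= d -> (0 < k)%N ->
  theta_DP R G k <= 2 * ln d / d.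
Proof.
move=> dE /andP[FG /forall_inP FA] A0 d4 k0; rewrite leNgt; apply/negP => lt_eta.
have [/andP[eta0 eta1] colorable] := @theta_DP_max R V G k k0.
set eta := theta_DP R G k in eta0 eta1 colorable lt_eta.
have kR : 0 < k%:R :> R by rewrite ltr0n.
have n0 : (0 < #|A|)%N by rewrite card_gt0.
have nR : 0 < #|A|%:R :> R by rewrite ltr0n.
(* [t] is the ceiling of [eta * k]: every colour set of size at least [eta * k] contains a
   [t]-subset. *)
have [t [et tmin]] : exists t, eta * k%:R <= t%:R /\
    forall i, eta * k%:R <= i%:R -> (t <= i)%N.
  have ex : exists t, eta * k%:R <= t%:R by exists k; rewrite ler_piMl // ltW.
  by case: (ex_minnP ex) => t ? ?; exists t.
have tk : (t <= k)%N by apply: tmin; rewrite ler_piMl // ltW.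
have dt : 2 * ln d / d <= t%:R / k%:R.
  by rewrite ler_pdivlMr // (le_trans _ et) // ler_wpM2r // ltW.
have t0 : (0 < t)%N.
  have : 0 < t%:R / k%:R :> R.
    by apply: lt_le_trans dt; rewrite divr_gt0 ?mulr_gt0 ?ln_gt0 //; lra.
  by rewrite pmulr_lgt0 ?invr_gt0 // ltr0n.
(* The choice [f] survives the matching [s] on [e]; the rank condition tests [s] in the direction in
   which [perm_adj] reads it. *)
pose good (e : {set V}) (s : 'S_k) (f : {ffun V -> {set 'I_k}}) :=
  [forall u, forall v, (e == [set u; v]%SET) && (enum_rank u < enum_rank v)%N ==>
    (s \in avoiding (f u) (f v))].
pose draws := [set B : {set 'I_k} | #|B| == t]%SET.
(* Choices are empty outside [A], so that the count has exponent [#|A|] rather than [#|V|]. *)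
pose X0 : {set {ffun V -> {set 'I_k}}} :=
  [set f in pffun_on (finset.set0 : {set 'I_k}) A draws]%SET.
have cX0 : #|X0| = ('C(k, t) ^ #|A|)%N.
  by rewrite cardsE card_pffun_on card_draws card_ord.
have fX0 f u : f \in X0 -> u \in A -> #|f u| = t.
  rewrite inE => /pffun_onP[_ fA] uA.
  by have := fA _ (fintype.image_f f uA); rewrite inE => /eqP.
have p0 : 0 <= (1 - t%:R / k%:R) ^+ t :> R.
  by rewrite exprn_ge0 // subr_ge0 ler_pdivrMr // mul1r ler_nat.
have [||sigma] := @conditional_expectations R _ _ _ good _ (enum F) X0 p0 (enum_uniq _).
- move=> e f; rewrite mem_enum => eF fX.
  have [u [v [eE uv]]] := edge_ranked G e (fintype.subsetP FG _ eF).
  have /fintype.subsetP eA := FA _ eF.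
  have uA : u \in A by apply: eA; rewrite eE set21.
  have vA : v \in A by apply: eA; rewrite eE set22.
  apply: (@le_trans _ _ #|avoiding (f u) (f v)|%:R).
    rewrite ler_nat subset_leq_card //; apply/fintype.subsetP => s.
    by rewrite inE => /forallP/(_ u)/forallP/(_ v); rewrite eE eqxx uv.
  by have := card_avoiding_le R (f u) (f v); rewrite !(fX0 f).
- by apply/card_gt0P; exists 1%g.
rewrite cX0 -cardE natrX mulrC.
have := @union_bound_lt1 R d k t #|A| #|F| d4 t0 tk n0 dt.
rewrite {1}dE /avg_degree divfK ?gt_eqF // natrM => /(_ erefl) lt1 le1.
(* A number of survivors below 1 is 0, so [sigma] defeats every choice in [X0]. *)
have := le_lt_trans le1 lt1; rewrite ltrn1 ltnS leqn0 => /eqP/cards0_eq X0E.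
have [C [CL CA]] := perm_cover G F sigma FG.
have [|S [Sind Scol]] := colorable _ C.
  by move=> u; rewrite CL card_fiber.
have /fin_all_exists2[f fS fc] (u : V) : exists2 B : {set 'I_k},
    B \subset [set i | (u, i) \in S]%SET & #|B| = t.
  apply: exists_subset_card; apply: tmin.
  by have := Scol u; rewrite CL card_fiber card_fiberI.
(* A colouring of the cover, trimmed to [t] colours at each vertex of [A], would be a survivor. *)
pose f' : {ffun V -> {set 'I_k}} := [ffun u => if u \in A then f u else finset.set0].
have : f' \in (finset.set0 : {set {ffun V -> {set 'I_k}}}).
  rewrite -X0E inE; apply/andP; split.
    rewrite inE; apply/pffun_onP; split.
      by apply/fintype.subsetP => u; rewrite inE ffunE; case: ifP; rewrite ?eqxx.
    move=> B /fintype.imageP[u uA ->]; rewrite ffunE uA inE; exact/eqP.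
  apply/allP => e; rewrite mem_enum => eF.
  apply/forallP => u; apply/forallP => v; apply/implyP => /andP[/eqP eE uv].
  rewrite inE; apply/forall_inP => a; rewrite !ffunE.
  case: ifP => [uA au|]; last by rewrite inE.
  case: ifP => [vA|]; last by rewrite inE.
  apply/negP => av.
  have aS : (u, a) \in S by have := fintype.subsetP (fS u) _ au; rewrite inE.
  have vS : (v, sigma e a) \in S by have := fintype.subsetP (fS v) _ av; rewrite inE.
  have uv' : u != v by apply: contraTneq uv => ->; rewrite ltnn.
  apply: (Sind _ _ aS vS); split.
    by rewrite CA /perm_adj /= (negbTE uv') -eE eF uv eqxx.
  by exists u, v; rewrite CL !inE.
by rewrite inE.
Qed.

(** Positivity excludes the default value 0 of the iterated maximum. *)
Lemma mad_attained (R : realType) (V : finType) (G : sgraph V) : 0 < mad R G ->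
  exists A F, [/\ is_subgraph G A F, A != finset.set0 & mad R G = avg_degree R A F].
Proof.
rewrite /mad; elim/big_ind: _ => [|x y IHx IHy|[A F] /= /andP[AF A0] _].
- by rewrite ltxx.
- by case: (leP x y).
- by exists A, F.
Qed.

Theorem theorem1p7 (R : realType) (V : finType) (G : sgraph V) (d : R)
    (hd : mad R G = d) (hd4 : 4 <= d) :
  ((d / (2 * ln d))%:E <= chi_DP_star R G)%E.
Proof.
have d0 : 0 < d by lra.
have ln0 : 0 < 2 * ln d by rewrite mulr_gt0 ?ln_gt0 //; lra.
have [|A [F [AF A0 dE]]] := mad_attained R V G; first by rewrite hd.
rewrite hd in dE; apply: le_ereal_inf_tmp => _ /= [k k0 <-].
(* If [theta_DP] vanishes, its extended inverse is infinite and the bound is immediate. *)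
rewrite inver; case: eqVneq => [_|th0]; first exact: leey.
have [/andP[eta0 _] _] := @theta_DP_max R V G k k0.
have thR : 0 < theta_DP R G k by rewrite lt_def th0.
rewrite lee_fin -invf_div lef_pV2 ?posrE ?divr_gt0 //.
exact: theta_DP_le dE AF A0 hd4 k0.
Qed.
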